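(* The integrality gap of the level-$k$ $\mathrm{LS}_+$ relaxation for \textsc{Knapsack} is at most $1+O(k^{-1/3})$.
   Context: A \textsc{Knapsack} instance has $n$ items, each item $i\in[n]$ with nonnegative reward $r_i$ and nonnegative cost $c_i$, and a capacity $C$; the goal is to choose $I\subseteq[n]$ with $\sum_{i\in I}c_i\le C$ maximizing $\sum_{i\in I}r_i$; $\mathrm{OPT}$ denotes this maximum. Let $P=\{{\bf x}\in[0,1]^n:\sum_i c_ix_i\le C\}$. Let $K^+_0(P)=\{(x_0,x_0{\bf x}) : x_0\ge 0,\ {\bf x}\in P\}\subseteq\mathbb R^{n+1}$. For ${\bf y}$ a vector indexed by subsets of $[n]$ of size at most $2$, the moment matrix $Y^{[{\bf y}]}$ is the $(n+1)\times(n+1)$ matrix with rows and columns indexed by the sets $\emptyset,\{1\},\dots,\{n\}$ (identified with $0,1,\dots,n$) whose $(A,B)$ entry is $y_{A\cup B}$; ${\bf e}_0,\dots,{\bf e}_n$ is the standard basis of $\mathbb R^{n+1}$. For $t\ge1$, $K^+_t(P)$ is the set of vectors $(x_0,x_0{\bf x})$ for which there exists such ${\bf y}$ with $Y^{[{\bf y}]}$ positive semidefinite, $(x_0,x_0{\bf x})=Y^{[{\bf y}]}{\bf e}_0$, and $Y^{[{\bf y}]}{\bf e}_i\in K^+_{t-1}(P)$ and $Y^{[{\bf y}]}({\bf e}_0-{\bf e}_i)\in K^+_{t-1}(P)$ for all $i\in[n]$. The level-$k$ $\mathrm{LS}_+$ relaxation is $\max\{\sum_i r_ix_i : (1,{\bf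 x})\in K^+_k(P)\}$, and its integrality gap is the supremum over instances of the ratio of its optimum to $\mathrm{OPT}$. *)

(* Defs.v *)
From HB Require Import structures.
From mathcomp Require Import all_boot all_order all_algebra.
From mathcomp Require Import all_classical all_reals all_analysis.

Set Implicit Arguments.
Unset Strict Implicit.
Unset Printing Implicit Defensive.

Import Order.TTheory GRing.Theory Num.Theory.
Local Open Scope classical_set_scope.
Local Open Scope ring_scope.

(* capacity_ge0 holds exactly when some subset of the items is feasible, i.e.,
   when the maximum OPT exists. *)
Record knapsack (R : realType) := Knapsack {
  items : nat;
  reward : 'I_items -> R;
  cost : 'I_items -> R;
  capacity : R;
  reward_ge0 : forall i, 0 <= reward i;
  cost_ge0 : forall i, 0 <= cost i;
  capacity_ge0 : 0 <= capacity
}.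

(* As set0 is feasible and rewards are nonnegative, the default value 0 does
   not affect the maximum. *)
Definition OPT (R : realType) (K : knapsack R) : R :=
  \big[Num.max/0]_(I : {set 'I_(items K)}
                    | \sum_(i in I) cost i <= capacity K)
    \sum_(i in I) reward i.

Definition knapsack_polytope (R : realType) (K : knapsack R) :
    set 'cV[R]_(items K) :=
  [set x | (forall i, 0 <= x i ord0 <= 1) /\
           \sum_i cost i * x i ord0 <= capacity K].

(* The vector (x0, x0 x); coordinate 0 is x0 and coordinate (lift ord0 i),
   for i : 'I_n, is x0 * x_i. *)
Definition homog (R : realType) (n : nat) (x0 : R) (x : 'cV[R]_n) :
    'cV[R]_n.+1 :=
  \col_(j < n.+1) if unlift ord0 j is Some i then x0 * x i ord0 else x0.

Definition psdmx (R : realType) (n : nat) (A : 'M[R]_n) : Prop :=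
  A^T = A /\ forall v : 'cV[R]_n, 0 <= (v^T *m A *m v) ord0 ord0.

Definition index_set (n : nat) (j : 'I_n.+1) : {set 'I_n} :=
  if unlift ord0 j is Some i then [set i] else finset.set0.

(* The vector y is total on subsets of 'I_n, but only its values at sets with
   at most two elements are used. *)
Definition moment_matrix (R : realType) (n : nat) (y : {set 'I_n} -> R) :
    'M[R]_n.+1 :=
  \matrix_(a, b) y (index_set a :|: index_set b).

Definition e_ (R : realType) (n : nat) (j : 'I_n.+1) : 'cV[R]_n.+1 :=
  delta_mx j ord0.

Fixpoint LSplus (R : realType) (n : nat) (P : set 'cV[R]_n) (t : nat) :
    set 'cV[R]_n.+1 :=
  match t with
  | 0%N => [set z | exists x0 x, [/\ 0 <= x0, P x & z = homog x0 x]]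
  | s.+1 =>
    [set z | exists x0 x, z = homog x0 x /\
      exists y : {set 'I_n} -> R,
        let Y := moment_matrix y in
        [/\ psdmx Y,
            z = Y *m e_ R ord0 &
            forall i : 'I_n,
              LSplus P s (Y *m e_ R (lift ord0 i)) /\
              LSplus P s (Y *m (e_ R ord0 - e_ R (lift ord0 i)))]]
  end.

Definition LSplus_value (R : realType) (k : nat) (K : knapsack R) : \bar R :=
  ereal_sup [set (\sum_i reward i * x i ord0)%:E | x in
    [set x : 'cV[R]_(items K) |
      LSplus (@knapsack_polytope R K) k (homog 1 x)]].

(* In \bar R, v / 0 is +oo for v > 0 and 0 / 0 is 0: an instance with OPT = 0
   makes the gap infinite unless its relaxation also has value 0. *)
Definition integrality_gap (R : realType) (k : nat) : \bar R :=
  ereal_sup (range (fun K : knapsack R => LSplus_value k K / (OPT K)%:E)%E).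

(* Main.v *)
Require Import Defs.
From HB Require Import structures.
From mathcomp Require Import all_boot all_order all_algebra.
From mathcomp Require Import all_classical all_reals all_analysis.
From mathcomp Require Import ring lra.

Import Order.TTheory GRing.Theory Num.Theory.
Local Open Scope ring_scope.

(* Call an item large if its reward exceeds OPT/m. If all large items but those
   of a set F whose coordinates equal 1 carry mass at most OPT/m, greedy rounding
   of the small items shows that the value is at most (1 + 2/m) OPT. Otherwise,
   testing positive semidefiniteness against the centered reward vector shows
   that some conditioning x_i = 1 either adds a large item to F at a loss of at
   most OPT/m^2, or gains OPT/(2m^3) in value. The first case happens at most m
   times and the value never exceeds 2 OPT, so about 2m^3 levels bring the gap
   down to 1 + 4/m. *)

(** * Greedy rounding of fractional knapsack solutions *)

Section FractionalRounding.
Variables (R : realType) (n : nat) (r c : 'I_n -> R).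
Hypotheses (r_ge0 : forall i, 0 <= r i) (c_ge0 : forall i, 0 <= c i).

(** The minimum is taken only over items of positive cost; for free items the left side of the
    inequality vanishes. *)
Lemma min_density (D : {set 'I_n}) : 0 < \sum_(i in D) c i ->
  exists2 i, i \in D & 0 < c i /\ forall j, j \in D -> r i / c i * c j <= r j.
Proof.
move=> cD_gt0.
have [i0 /andP[i0D ci0]] : exists i, (i \in D) && (0 < c i).
  apply/existsP; rewrite -[X in is_true X]negbK negb_exists; apply/negP=> /forallP c0.
  move: cD_gt0; rewrite big1 ?ltxx// => i iD.
  by apply/eqP; rewrite eq_le c_ge0 andbT leNgt; have := c0 i; rewrite iD.
have P0 : (i0 \in D) && (0 < c i0) by apply/andP.
case: (@arg_minP _ R _ i0
  (fun i => (i \in D) && (0 < c i)) (fun i => r i / c i) P0) => i /andP[iD ci] imin.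
exists i => //; split=> // j jD.
have [cj|cj] := ltP 0 (c j); first by rewrite -ler_pdivlMr// imin// jD.
have -> : c j = 0 by apply/eqP; rewrite eq_le cj c_ge0.
by rewrite mulr0.
Qed.

(* If D without its least dense item i still exceeds the budget, the fractional
   mass of i can be moved to the other items at equal cost. *)
Lemma fractional_rounding (rho : R) (D : {set 'I_n}) (B : R) (x : 'I_n -> R) :
  0 <= rho -> (forall i, i \in D -> r i <= rho) ->
  0 <= B -> (forall i, 0 <= x i <= 1) -> \sum_(i in D) c i * x i <= B ->
  exists I : {set 'I_n}, [/\ I \subset D, \sum_(i in I) c i <= B &
    \sum_(i in D) r i * x i <= \sum_(i in I) r i + rho].
Proof.
move=> rho_ge0; move: {2}#|D| (leqnn #|D|) => d.
elim: d => [|d IH] in D x *; move=> cardD rD B_ge0 x01 cx.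
  exists finset.set0; move: cardD; rewrite leqn0 cards_eq0 => /eqP ->.
  by split; rewrite ?finset.sub0set ?big_set0 ?add0r.
have rx_le (E : {set 'I_n}) : \sum_(i in E) r i * x i <= \sum_(i in E) r i.
  apply: ler_sum => i _; have /andP[_ x1] := x01 i.
  by rewrite ler_piMr.
have [cD|cD] := leP (\sum_(i in D) c i) B.
  by exists D; split=> //; rewrite (le_trans (rx_le D))// lerDl.
have [i iD [ci dens]] := min_density D (le_lt_trans B_ge0 cD).
have sD : D :\ i \subset D by rewrite finset.subD1set.
have [cDi|cDi] := leP (\sum_(j in D :\ i) c j) B.
  exists (D :\ i); split=> //; rewrite (le_trans (rx_le D))//.
  by rewrite (big_setD1 i)//= addrC lerD2l rD.
(* [T] is the cost of raising all items of [D] other than [i] to 1. As these items overflow the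
   budget, [T] exceeds the cost [c i * x i] spent on [i], and [s] is the share of [T] that this cost
   pays for. *)
pose T := \sum_(j in D :\ i) c j * (1 - x j).
have TE : T = \sum_(j in D :\ i) c j - \sum_(j in D :\ i) c j * x j.
  by rewrite -sumrB; apply: eq_bigr => j _; rewrite mulrBr mulr1.
move: (cx); rewrite (big_setD1 i)//= => cx'.
have /andP[xi0 xi1] := x01 i.
have cxi0 : 0 <= c i * x i by rewrite mulr_ge0.
have cxT : c i * x i < T by rewrite TE; lra.
have T_gt0 : 0 < T by apply: le_lt_trans cxT.
pose s := c i * x i / T.
have s0 : 0 <= s by rewrite divr_ge0// ltW.
have s1 : s <= 1 by rewrite ler_pdivrMr// mul1r ltW.
have sT : s * T = c i * x i by rewrite /s divfK// gt_eqF.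
have [|||||I [ID cI rI]] := IH (D :\ i) (fun j => x j + s * (1 - x j)).
- by move: cardD; rewrite (cardsD1 i) iD.
- by move=> j /(fintype.subsetP sD); exact: rD.
- by [].
- by move=> j; have /andP[? ?] := x01 j; apply/andP; split; nra.
- have -> : \sum_(j in D :\ i) c j * (x j + s * (1 - x j)) =
      \sum_(j in D :\ i) c j * x j + s * T.
    by rewrite mulr_sumr -big_split /=; apply: eq_bigr => j _; ring.
  by rewrite sT addrC.
exists I; split=> //; first exact: fintype.subset_trans ID sD.
apply: le_trans rI; rewrite (big_setD1 i)//= addrC.
have -> : \sum_(j in D :\ i) r j * (x j + s * (1 - x j)) =
    \sum_(j in D :\ i) r j * x j + s * \sum_(j in D :\ i) r j * (1 - x j).
  by rewrite mulr_sumr -big_split /=; apply: eq_bigr => j _; ring.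
rewrite lerD2l.
(* The moved cost earns density [r i / c i] at [i], the least in [D], hence no less on the other
   items. *)
have -> : r i * x i = s * (r i / c i * T).
  by rewrite mulrCA sT; field; rewrite gt_eqF.
rewrite ler_wpM2l// mulr_sumr; apply: ler_sum => j /(fintype.subsetP sD) jD.
by rewrite mulrA ler_wpM2r ?dens// subr_ge0; have /andP[] := x01 j.
Qed.

End FractionalRounding.

(** * Feasible sets, the cone over the polytope and moment columns *)

Lemma sum_setU {V : nmodType} {T : finType} {A B : {set T}} (f : T -> V) :
  [disjoint A & B] ->
  \sum_(i in A :|: B) f i = \sum_(i in A) f i + \sum_(i in B) f i.
Proof.
by move=> dAB; rewrite -bigU//; apply: eq_bigl => i; rewrite !inE.
Qed.

Lemma OPT_ge {R : realType} {K : knapsack R} (I : {set 'I_(items K)}) :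
  \sum_(i in I) cost i <= capacity K -> \sum_(i in I) reward i <= OPT K.
Proof. by move=> cI; rewrite /OPT (bigD1 I)//= le_max lexx. Qed.

Lemma OPT_ge0 {R : realType} (K : knapsack R) : 0 <= OPT K.
Proof.
by have := @OPT_ge R K finset.set0; rewrite !big_set0; apply; exact: capacity_ge0.
Qed.

Definition value {R : realType} (K : knapsack R) (z : 'cV[R]_(items K).+1) : R :=
  \sum_i reward i * z (lift ord0 i) ord0.

(** The cone over the polytope, written without division: the inequalities are closed under sums and
    force [z] to be 0 when its coordinate 0 is. *)
Definition in_cone {R : realType} (K : knapsack R)
    (z : 'cV[R]_(items K).+1) : Prop :=
  [/\ 0 <= z ord0 ord0,
      forall i, 0 <= z (lift ord0 i) ord0 <= z ord0 ord0 &
      \sum_i cost i * z (lift ord0 i) ord0 <= capacity K * z ord0 ord0].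

Section Knapsack.
Variables (R : realType) (K : knapsack R).
Local Notation n := (items K).
Local Notation P := (@knapsack_polytope R K).
Local Notation opt := (OPT K).
Implicit Types (z : 'cV[R]_n.+1) (F D : {set 'I_n}).

Lemma in_coneD {z1 z2} : in_cone K z1 -> in_cone K z2 -> in_cone K (z1 + z2).
Proof.
move=> [a1 b1 c1] [a2 b2 c2]; split; first by rewrite mxE addr_ge0.
  by move=> i; rewrite !mxE; have := b1 i; have := b2 i; lra.
rewrite !mxE mulrDr (le_trans _ (lerD c1 c2))// -big_split /=.
by apply: ler_sum => i _; rewrite mxE mulrDr.
Qed.

Lemma moment_colE (y : {set 'I_n} -> R) (a b : 'I_n.+1) :
  (moment_matrix y *m e_ R b) a ord0 = y (index_set a :|: index_set b).
Proof. by rewrite -[_ *m _]colE !mxE. Qed.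

Lemma index_set0 : index_set (ord0 : 'I_n.+1) = finset.set0.
Proof. by rewrite /index_set unlift_none. Qed.

Lemma index_set_lift (i : 'I_n) : index_set (lift ord0 i) = [set i]%SET.
Proof. by rewrite /index_set liftK. Qed.

(** For any item [i], [z] is the sum of the images of [e_i] and [e_0 - e_i], which lie in the cone
    by induction. *)
Lemma LSplus_in_cone {t z} : LSplus P t z -> in_cone K z.
Proof.
elim: t z => [|t IH] z /=.
  move=> [x0 [x [x0_ge0 [x01 cx] ->]]]; split.
  - by rewrite mxE unlift_none.
  - move=> i; rewrite !mxE liftK unlift_none; have /andP[? ?] := x01 i.
    by rewrite mulr_ge0//= ler_piMr.
  - rewrite mxE unlift_none mulrC (le_trans _ (ler_wpM2l x0_ge0 cx))//.
    rewrite mulr_sumr; apply: ler_sum => i _.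
    by rewrite mxE liftK mulrCA.
move=> [x0 [x [_ [y [[_ Ypsd] zE Yi]]]]].
have ind (i : 'I_n) : in_cone K z.
  have [/IH c1 /IH c2] := Yi i.
  by have := in_coneD c1 c2; rewrite -mulmxDr addrC subrK -zE.
(* Without items there is no [i] to split on, so the sign is read off the diagonal of the psd
   matrix. *)
have z0 : 0 <= z ord0 ord0.
  have := Ypsd (e_ R ord0); rewrite -mulmxA -zE.
  by rewrite /e_ trmx_delta -rowE mxE.
split=> // [i|]; first by have [_ + _] := ind i; apply.
have [n0|n_gt0] := posnP n; last by have [] := ind (Ordinal n_gt0).
rewrite big1 ?mulr_ge0 ?capacity_ge0// => i _.
by case: i => i i_lt; exfalso; move: i_lt; rewrite n0.
Qed.

(** [M i] is [z] conditioned on [x_i = 1], not normalized. The last inequality says that the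
    pseudo-variance of the reward is nonnegative. *)
Lemma LSplus_columns {t z} : LSplus P t.+1 z -> 0 < z ord0 ord0 ->
  exists M : 'I_n -> 'cV[R]_n.+1, [/\
    forall i, LSplus P t (M i) /\ in_cone K (z - M i),
    forall i, M i ord0 ord0 = z (lift ord0 i) ord0,
    forall i, M i (lift ord0 i) ord0 = z (lift ord0 i) ord0 &
    value K z ^+ 2 <= z ord0 ord0 * \sum_i reward i * value K (M i)].
Proof.
move=> [x0 [x [_ [y [[_ Ypsd] zE Yi]]]]] z0.
pose Y := moment_matrix y.
exists (fun i => Y *m e_ R (lift ord0 i)); split.
- move=> i; have [h1 h2] := Yi i; split=> //.
  by have := LSplus_in_cone h2; rewrite mulmxBr -zE.
- by move=> i; rewrite zE !moment_colE finset.setUC.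
- by move=> i; rewrite zE !moment_colE index_set0 index_set_lift finset.setUid finset.setU0.
(* [v] encodes the reward minus its mean, scaled by [z ord0 ord0]; centering makes coordinate 0 of
   [Y *m v] vanish. *)
pose v : 'cV[R]_n.+1 := \col_j (if unlift ord0 j is Some i
  then z ord0 ord0 * reward i else - value K z).
have v0 : v ord0 ord0 = - value K z by rewrite mxE unlift_none.
have vS i : v (lift ord0 i) ord0 = z ord0 ord0 * reward i by rewrite mxE liftK.
have zY i : Y i ord0 = z i ord0 by rewrite zE moment_colE mxE.
have zY' i : Y ord0 i = z i ord0 by rewrite zE moment_colE mxE finset.setUC.
have Yv a : (Y *m v) a ord0 =
    - (z a ord0 * value K z) + z ord0 ord0 * \sum_i reward i * Y a (lift ord0 i).
  rewrite mxE big_ord_recl zY v0 mulrN mulr_sumr; congr (_ + _).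
  by apply: eq_bigr => i _; rewrite vS; ring.
have Y0 : (Y *m v) ord0 ord0 = 0.
  rewrite Yv; apply/eqP; rewrite addrC subr_eq0; apply/eqP; congr (_ * _).
  by apply: eq_bigr => i _; rewrite zY'.
have YS i : (Y *m v) (lift ord0 i) ord0 = - (z (lift ord0 i) ord0 * value K z) +
    z ord0 ord0 * value K (Y *m e_ R (lift ord0 i)).
  rewrite Yv; congr (_ + _ * _); apply: eq_bigr => j _.
  by rewrite moment_colE mxE finset.setUC.
have := Ypsd v; rewrite -/Y -mulmxA mxE big_ord_recl Y0 mulr0 add0r.
have -> : \sum_(i < n) v^T ord0 (lift ord0 i) * (Y *m v) (lift ord0 i) ord0 =
    z ord0 ord0 * (z ord0 ord0 *
      (\sum_i reward i * value K (Y *m e_ R (lift ord0 i))) - value K z ^+ 2).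
  rewrite expr2 {2}/value mulr_sumr mulr_suml -sumrB mulr_sumr.
  by apply: eq_bigr => i _; rewrite YS mxE vS; ring.
by rewrite pmulr_rge0// subr_ge0.
Qed.

(** * Upper bounds on the value *)

Lemma in_cone_fixed_cost {z F} : in_cone K z -> 0 < z ord0 ord0 ->
  (forall i, i \in F -> z (lift ord0 i) ord0 = z ord0 ord0) ->
  forall D, [disjoint F & D] -> \sum_(i in F) cost i +
    \sum_(i in D) cost i * (z (lift ord0 i) ord0 / z ord0 ord0) <= capacity K.
Proof.
move=> [_ zb cz] z0 zF D dFD.
rewrite -(ler_pM2r z0) (le_trans _ cz)// mulrDl !mulr_suml.
apply: (@le_trans _ _ (\sum_(i in F :|: D) cost i * z (lift ord0 i) ord0)).
  rewrite sum_setU// lerD// ler_sum// => i iD.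
    by rewrite zF.
  by rewrite mulrA divfK// gt_eqF.
rewrite [leRHS](bigID (fun i => i \in F :|: D))/= lerDl sumr_ge0// => i _.
by rewrite mulr_ge0 ?cost_ge0//; have /andP[] := zb i.
Qed.

(** Packing [F] whole and rounding [D] within the remaining budget gives a feasible set and loses at
    most [rho]. *)
Lemma lp_bound {rho : R} {z F D} : 0 <= rho -> in_cone K z -> 0 < z ord0 ord0 ->
  (forall i, i \in F -> z (lift ord0 i) ord0 = z ord0 ord0) ->
  (forall i, i \in D -> reward i <= rho) -> [disjoint F & D] ->
  \sum_(i in F :|: D) reward i * z (lift ord0 i) ord0 <=
    (opt + rho) * z ord0 ord0.
Proof.
move=> rho0 cz z0 zF rD dFD.
have cFD := in_cone_fixed_cost cz z0 zF D dFD.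
pose x i := z (lift ord0 i) ord0 / z ord0 ord0.
have x01 i : 0 <= x i <= 1.
  have [_ /(_ i) /andP[zi0 zi1] _] := cz.
  apply/andP; split; first exact: divr_ge0 (ltW z0).
  by rewrite /x ler_pdivrMr// mul1r.
have cx0 : 0 <= \sum_(i in D) cost i * x i.
  by apply: sumr_ge0 => i _; rewrite mulr_ge0 ?cost_ge0//; have /andP[] := x01 i.
have cxB : \sum_(i in D) cost i * x i <= capacity K - \sum_(i in F) cost i.
  by rewrite lerBrDl.
have [I [ID cI rI]] := fractional_rounding _ _ _ _ (@reward_ge0 _ K)
  (@cost_ge0 _ K) _ _ _ _ rho0 rD (le_trans cx0 cxB) x01 cxB.
have dFI : [disjoint F & I] by apply: disjointWr dFD.
have : \sum_(i in F :|: I) reward i <= opt.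
  by apply: OPT_ge; rewrite sum_setU// -lerBrDl.
rewrite !sum_setU// => optFI.
rewrite -ler_pdivrMr// mulrDl !mulr_suml.
have -> : \sum_(i in F) reward i * z (lift ord0 i) ord0 / z ord0 ord0 =
    \sum_(i in F) reward i.
  by apply: eq_bigr => i iF; rewrite zF// mulfK// gt_eqF.
have -> : \sum_(i in D) reward i * z (lift ord0 i) ord0 / z ord0 ord0 =
    \sum_(i in D) reward i * x i by apply: eq_bigr => i _; rewrite mulrA.
lra.
Qed.

(** Coordinates 0 and [i] of the column [M i] agree, so its capacity constraint would have to pay
    for the whole of item [i]. *)
Lemma LSplus_costly {t z i} : LSplus P t.+1 z -> 0 < z ord0 ord0 ->
  capacity K < cost i -> z (lift ord0 i) ord0 = 0.
Proof.
move=> Lz z0 ci; have [M [ML M0 Mi _]] := LSplus_columns Lz z0.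
have [_ /(_ i) /andP[zi0 _] _] := LSplus_in_cone Lz.
have [_ Mb] := LSplus_in_cone (ML i).1.
rewrite M0 (bigD1 i)//= Mi => cM.
have : cost i * z (lift ord0 i) ord0 <= capacity K * z (lift ord0 i) ord0.
  apply: le_trans cM; rewrite lerDl sumr_ge0// => j _.
  by rewrite mulr_ge0 ?cost_ge0//; have /andP[] := Mb j.
nra.
Qed.

(** Each item that fits alone has reward at most [opt], so rounding with [rho = opt] applies; the
    other items have coordinate 0. *)
Lemma value_le2 {t z} : LSplus P t.+1 z -> 0 < z ord0 ord0 ->
  value K z <= 2 * opt * z ord0 ord0.
Proof.
move=> Lz z0; pose D := [set i : 'I_n | cost i <= capacity K]%SET.
have rD i : i \in D -> reward i <= opt.
  rewrite inE => ci; have := @OPT_ge _ K [set i]%SET.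
  by rewrite !big_set1; apply.
have zF i : i \in finset.set0 -> z (lift ord0 i) ord0 = z ord0 ord0.
  by rewrite inE.
have dD : [disjoint (finset.set0 : {set 'I_n}) & D].
  by rewrite -setI_eq0 finset.set0I.
have := lp_bound (OPT_ge0 K) (LSplus_in_cone Lz) z0 zF rD dD.
rewrite finset.set0U (_ : 2 * opt = opt + opt); last by ring.
apply: le_trans.
rewrite /value (bigID (fun i => i \in D))/= [X in _ + X]big1 ?addr0// => i.
by rewrite inE -ltNge => /(LSplus_costly Lz z0) ->; rewrite mulr0.
Qed.

Lemma in_cone_value0 {z} : in_cone K z -> z ord0 ord0 = 0 -> value K z = 0.
Proof.
move=> [_ zb _] z0; apply: big1 => i _; have := zb i.
by rewrite z0 -eq_le => /eqP <-; rewrite mulr0.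
Qed.

(** * Conditioning on an item and the potential argument *)

Lemma pick_column {M : 'I_n -> 'cV[R]_n.+1} {T : {set 'I_n}} {a : R} :
  (forall i, in_cone K (M i)) ->
  0 < \sum_(i in T) reward i * (value K (M i) - a * M i ord0 ord0) ->
  exists i, [/\ i \in T, 0 < M i ord0 ord0 &
    a <= value K (M i) / M i ord0 ord0].
Proof.
move=> Mc; rewrite ltNge => /negP sum_le0; apply: contrapT => no_i.
apply: sum_le0; apply: sumr_le0 => i iT.
rewrite mulr_ge0_le0 ?reward_ge0// subr_le0.
have [M0 _ _] := Mc i.
(* A column that cannot be normalized has value 0 and contributes nothing to the sum. *)
have [M00|M_neq0] := eqVneq (M i ord0 ord0) 0.
  by rewrite in_cone_value0// M00 mulr0.
have M_gt0 : 0 < M i ord0 ord0 by rewrite lt_neqAle eq_sym M_neq0.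
rewrite -ler_pdivrMr// leNgt; apply/negP => /ltW aM.
by apply: no_i; exists i.
Qed.

Definition ratio z : R := value K z / z ord0 ord0.

Definition fixed_large (rho : R) F z : Prop :=
  forall i, i \in F -> rho < reward i /\ z (lift ord0 i) ord0 = z ord0 ord0.

Lemma fixed_large_card {m : nat} {F z} : 0 < opt -> (0 < m)%N ->
  in_cone K z -> 0 < z ord0 ord0 -> fixed_large (opt / m%:R) F z ->
  (#|F| <= m)%N.
Proof.
move=> opt0 m0 cz z0 Fz.
have := in_cone_fixed_cost cz z0 (fun i iF => (Fz i iF).2) finset.set0.
rewrite big_set0 addr0 -setI_eq0 finset.setI0 eqxx => /(_ isT).
move/OPT_ge; apply: contraTT; rewrite -ltnNge -ltNge => mF.
have m0R : 0 < m%:R :> R by rewrite ltr0n.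
apply: (@lt_le_trans _ _ (#|F|%:R * (opt / m%:R))).
  by rewrite mulrCA ltr_pMr// ltr_pdivlMr// mul1r ltr_nat.
rewrite mulr_natl -sumr_const; apply: ler_sum => i iF.
by have [/ltW] := Fz i iF.
Qed.

Lemma ratio_terminal {rho : R} {F z} : 0 <= rho ->
  in_cone K z -> 0 < z ord0 ord0 -> fixed_large rho F z ->
  \sum_(i | (rho < reward i) && (i \notin F)) reward i * z (lift ord0 i) ord0
    <= rho * z ord0 ord0 ->
  ratio z <= opt + 2 * rho.
Proof.
move=> rho0 cz z0 Fz small.
pose D := [set i : 'I_n | reward i <= rho]%SET.
have rD i : i \in D -> reward i <= rho by rewrite inE.
have dFD : [disjoint F & D].
  apply/pred0P => i /=; apply/negP => /andP[/Fz[+ _]].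
  by rewrite inE leNgt => ->.
have lp := lp_bound rho0 cz z0 (fun i iF => (Fz i iF).2) rD dFD.
rewrite /ratio ler_pdivrMr// /value (bigID (fun i => i \in F :|: D))/=.
rewrite [leRHS](_ : _ = (opt + rho) * z ord0 ord0 + rho * z ord0 ord0); last by ring.
rewrite lerD//; apply: le_trans small.
rewrite le_eqVlt; apply/orP; left; apply/eqP; apply: eq_bigl => i.
by rewrite !inE negb_or -ltNge andbC.
Qed.

(** Neither [z'] nor [z - z'] has a coordinate above its coordinate 0, so equality for their sum
    forces equality for [z']. *)
Lemma fixed_large_column (rho : R) F z z' :
  in_cone K z' -> in_cone K (z - z') -> fixed_large rho F z ->
  fixed_large rho F z'.
Proof.
move=> [_ b' _] [_ b _] Fz i iF; have [ri zi] := Fz i iF; split=> //.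
have /andP[_ h1] := b' i; have := b i; rewrite !mxE zi => /andP[_ h2].
by apply/eqP; rewrite eq_le h1; move: h2; rewrite lerD2l lerN2.
Qed.

(* Positive semidefiniteness makes the reward-weighted average of the
   conditional values at least the current value, so either the large items
   lose little or the other ones gain. *)
Lemma LSplus_condition {t} {rho l g : R} {F z} :
  0 < opt -> 0 < rho -> 0 < g -> l * rho = g * (2 * opt) ->
  LSplus P t.+1 z -> 0 < z ord0 ord0 -> fixed_large rho F z ->
  opt + 2 * rho < ratio z ->
  exists z' F', [/\ LSplus P t z', 0 < z' ord0 ord0, fixed_large rho F' z' &
    (F' = F /\ ratio z + g <= ratio z') \/
    (#|F'| = #|F|.+1 /\ ratio z - l <= ratio z')].
Proof.
move=> opt0 rho0 g0 lg Lz z0 Fz big_z.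
have cz := LSplus_in_cone Lz.
have [M [ML M0 Mi psd]] := LSplus_columns Lz z0.
have Mc i := LSplus_in_cone (ML i).1.
pose T := [set i : 'I_n | (rho < reward i) && (i \notin F)]%SET.
pose gain (A : {set 'I_n}) := \sum_(i in A) reward i * (value K (M i) - ratio z * M i ord0 ord0).
pose mass (A : {set 'I_n}) := \sum_(i in A) reward i * z (lift ord0 i) ord0.
have shift (A : {set 'I_n}) (b : R) : \sum_(i in A) reward i *
    (value K (M i) - (ratio z + b) * M i ord0 ord0) = gain A - b * mass A.
  by rewrite mulr_sumr -sumrB; apply: eq_bigr => i _; rewrite -M0; ring.
have gain_ge0 : 0 <= gain T + gain (~: T).
  have -> : gain T + gain (~: T) =
      \sum_i reward i * (value K (M i) - ratio z * M i ord0 ord0).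
    rewrite [RHS](bigID (fun i => i \in T))/=; congr (_ + _).
    by apply: eq_bigl => i; rewrite inE.
  rewrite -(pmulr_rge0 _ z0).
  have -> : \sum_i reward i * (value K (M i) - ratio z * M i ord0 ord0) =
      \sum_i reward i * value K (M i) - ratio z * value K z.
    by rewrite [in RHS]mulr_sumr -sumrB; apply: eq_bigr => i _; rewrite M0; ring.
  have -> : z ord0 ord0 * (\sum_i reward i * value K (M i) -
      ratio z * value K z) =
      z ord0 ord0 * (\sum_i reward i * value K (M i)) - value K z ^+ 2.
    by rewrite /ratio; field; rewrite gt_eqF.
  by rewrite subr_ge0.
have mass_le : mass T + mass (~: T) = value K z.
  rewrite /value [RHS](bigID (fun i => i \in T))/=; congr (_ + _).
  by apply: eq_bigl => i; rewrite inE.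
have mass_ge0 (A : {set 'I_n}) : 0 <= mass A.
  apply: sumr_ge0 => i _; rewrite mulr_ge0 ?reward_ge0//.
  by have [_ /(_ i) /andP[]] := cz.
have massT : rho * z ord0 ord0 < mass T.
  rewrite ltNge; apply/negP => h; move: big_z; rewrite ltNge => /negP; apply.
  apply: (ratio_terminal (ltW rho0) cz z0 Fz).
  apply: le_trans h; rewrite le_eqVlt; apply/orP; left; apply/eqP.
  by apply: eq_bigl => i; rewrite inE.
have massTC : mass (~: T) <= 2 * opt * z ord0 ord0.
  by rewrite (le_trans _ (value_le2 Lz z0))// -mass_le lerDr.
have l0 : 0 < l by rewrite -(pmulr_lgt0 _ rho0) lg; nra.
have FM i : fixed_large rho F (M i).
  exact: fixed_large_column (Mc i) (ML i).2 Fz.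
(* The threshold equals [- l * rho * z ord0 ord0]. Above it, [massT] makes [gain T + l * mass T]
   positive; below it, the complement gains more than [g] times its mass. *)
have [gainT|gainT] := leP (- (g * (2 * opt) * z ord0 ord0)) (gain T).
  have [|i [iT Mi0 Mr]] := @pick_column M T (ratio z - l) Mc.
    rewrite shift; nra.
  exists (M i), (i |: F); split=> //; first exact: (ML i).1.
    move=> j; rewrite in_setU1 => /orP[/eqP ->|]; last exact: FM.
    by move: iT; rewrite inE => /andP[]; rewrite Mi M0.
  right; split=> //; rewrite cardsU1.
  by move: iT; rewrite inE => /andP[_ ->].
have [|i [iT Mi0 Mr]] := @pick_column M (~: T) (ratio z + g) Mc.
  rewrite shift; nra.
by exists (M i), F; split; [exact: (ML i).1| |exact: FM|left].
Qed.

(* The potential [ratio z - (m - #|F|) * (l + g)] grows by g at each level,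
   because large items are conditioned on at most m times. *)
Lemma ratio_potential {t m : nat} {l g : R} {F z} :
  0 < opt -> (0 < m)%N -> 0 < g -> l * (opt / m%:R) = g * (2 * opt) ->
  LSplus P t.+1 z -> 0 < z ord0 ord0 -> fixed_large (opt / m%:R) F z ->
  let D := ratio z - (opt + 2 * (opt / m%:R)) - (m%:R - #|F|%:R) * (l + g) in
  0 < D -> D + t%:R * g <= opt.
Proof.
move=> opt0 m0 g0 lg; have m0' : 0 < m%:R :> R by rewrite ltr0n.
have rho0 : 0 < opt / m%:R by rewrite divr_gt0.
have l0 : 0 < l by rewrite -(pmulr_lgt0 _ rho0) lg; nra.
elim: t => [|t IH] in F z *; move=> Lz z0 Fz /= D0;
  have := fixed_large_card opt0 m0 (LSplus_in_cone Lz) z0 Fz;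
  rewrite -(ler_nat R) => Fm.
  have : ratio z <= 2 * opt by rewrite ler_pdivrMr// (value_le2 Lz z0).
  nra.
have [|z' [F' [Lz' z'0 Fz' step]]] := LSplus_condition opt0 rho0 g0 lg Lz z0 Fz.
  nra.
have := IH F' z' Lz' z'0 Fz'; rewrite /= -[t.+1%:R]natr1.
case: step => -[-> h]; first by move=> IH'; have := IH' ltac:(lra); lra.
(* A new item in [F] raises the potential by [l + g], which pays for the loss [l] and leaves [g]. *)
rewrite -[#|F|.+1%:R]natr1 => IH'.
have := IH' ltac:(lra); lra.
Qed.

(** * Choice of parameters and the integrality gap *)

Lemma homog0E (x : 'cV[R]_n) : homog 1 x ord0 ord0 = 1.
Proof. by rewrite mxE unlift_none. Qed.

Lemma value_homog (x : 'cV[R]_n) :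
  value K (homog 1 x) = \sum_i reward i * x i ord0.
Proof. by apply: eq_bigr => i _; rewrite mxE liftK mul1r. Qed.

Lemma LSplus_reward_le2 {k : nat} {x : 'cV[R]_n} : (0 < k)%N ->
  LSplus P k (homog 1 x) -> \sum_i reward i * x i ord0 <= 2 * opt.
Proof.
case: k => // k _ Lx.
by have := value_le2 Lx; rewrite homog0E value_homog mulr1; apply.
Qed.

(** With [g = opt / (2 m^3)] and [l = opt / m^2], a value above the bound makes the initial
    potential positive, and [2 m^3] gains of [g] already add up to [opt]. The strict inequality
    reserves one level for the final bound [2 * opt]. *)
Lemma LSplus_reward_le {k m : nat} {x : 'cV[R]_n} :
  0 < opt -> (0 < m)%N -> (2 * m ^ 3 < k)%N -> LSplus P k (homog 1 x) ->
  \sum_i reward i * x i ord0 <= (1 + 4 / m%:R) * opt.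
Proof.
case: k => // k opt0 m0; rewrite ltnS -(ler_nat R) natrM natrX => mk Lx.
set u := m%:R^-1.
have m1 : 1 <= m%:R :> R by rewrite ler1n.
have mu : m%:R * u = 1 by rewrite divff// gt_eqF// ltr0n.
have u0 : 0 < u by rewrite invr_gt0 ltr0n.
have g0 : 0 < opt * u ^+ 3 / 2 by rewrite divr_gt0// mulr_gt0// exprn_gt0.
have lg : (opt * u ^+ 2) * (opt / m%:R) = (opt * u ^+ 3 / 2) * (2 * opt).
  by rewrite -/u; field.
have z0 : 0 < homog 1 x ord0 ord0 by rewrite homog0E.
have F0 : fixed_large (opt / m%:R) finset.set0 (homog 1 x).
  by move=> i; rewrite inE.
have := ratio_potential opt0 m0 g0 lg Lx z0 F0.
rewrite /= /ratio value_homog homog0E divr1 cards0 subr0 -/u.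
set v := \sum_i _ => D_le; rewrite leNgt; apply/negP => v_gt.
have u1 : u <= 1 by rewrite invf_le1// ltr0n.
have muE : m%:R * (opt * u ^+ 2 + opt * u ^+ 3 / 2) = opt * u + opt * u ^+ 2 / 2.
  have -> : m%:R * (opt * u ^+ 2 + opt * u ^+ 3 / 2) =
    (m%:R * u) * (opt * u + opt * u ^+ 2 / 2) by field.
  by rewrite mu mul1r.
have kg : opt <= k%:R * (opt * u ^+ 3 / 2).
  have : (2 * m%:R ^+ 3) * (opt * u ^+ 3 / 2) <= k%:R * (opt * u ^+ 3 / 2).
    by rewrite ler_wpM2r// ltW.
  apply: le_trans.
  have -> : 2 * m%:R ^+ 3 * (opt * u ^+ 3 / 2) = opt * (m%:R * u) ^+ 3 by field.
  by rewrite mu expr1n mulr1.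
have uu : opt * u ^+ 2 <= opt * u by rewrite ler_wpM2l ?ltW// expr2; nra.
have ou : 0 < opt * u by rewrite mulr_gt0.
have v_gt' : opt + 4 * (opt * u) < v by apply: le_lt_trans v_gt; lra.
have D0 : 0 < v - (opt + 2 * (opt * u)) -
    m%:R * (opt * u ^+ 2 + opt * u ^+ 3 / 2) by rewrite muE; lra.
by have := D_le D0; lra.
Qed.

End Knapsack.

Theorem theorem3 (R : realType) :
  exists A : R, 0 < A /\
    forall k : nat, (1 <= k)%N ->
      (integrality_gap R k <= (1 + A * (k%:R `^ (- 3^-1)))%:E)%E.
Proof.
(* [12 = 4 * 3]: the bound is [1 + 4 / m], and [k <= 16 m^3] yields [1 / m <= 3 k^(-1/3)] since
   [16 < 27]. *)
exists 12; split=> // k k_gt0.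
set s := k%:R `^ _.
have s_gt0 : 0 < s by rewrite powR_gt0// ltr0n.
have ks : k%:R * s ^+ 3 = 1.
  rewrite -powR_mulrn ?ltW// -powRrM mulNr mulVf ?pnatr_eq0// powR_inv1//.
  by rewrite divff// pnatr_eq0 -lt0n.
apply: ge_ereal_sup => _ [K _ <-].
have [opt_gt0|opt_le0] := ltP 0 (OPT K); last first.
  have opt0 : OPT K = 0 by apply/eqP; rewrite eq_le opt_le0 OPT_ge0.
  have val_le0 : (LSplus_value k K <= 0)%E.
    apply: ge_ereal_sup => _ [x /= Lx <-].
    by rewrite lee_fin (le_trans (LSplus_reward_le2 _ _ k_gt0 Lx))// opt0 mulr0.
  (* The inverse of 0 is [+oo], and a nonpositive value times [+oo] is nonpositive. *)
  rewrite opt0 inve0; apply: (@le_trans _ _ 0%E).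
    by rewrite mule_le0_ge0.
  by rewrite lee_fin addr_ge0// mulr_ge0// ltW.
rewrite inver gt_eqF// lee_pdivrMr// -EFinM.
apply: ge_ereal_sup => _ [x /= Lx <-]; rewrite lee_fin.
pose small m := (2 * m ^ 3 < k)%N.
have small0 : exists m, small m by exists 0.
have small_le m : small m -> (m <= k)%N.
  move/ltnW; apply: leq_trans; case: m => // m.
  by rewrite -[leqLHS]mul1n leq_mul// -[leqLHS]expn1 leq_pexp2l.
case: (ex_maxnP small0 small_le) => m m_small m_max.
have k_le : (k <= 2 * m.+1 ^ 3)%N.
  by rewrite leqNgt; apply/negP => /m_max; rewrite ltnn.
(* [m = 0] means [k <= 2]; the factor 2 then suffices because [12 * s >= 1]. *)
have [m0|m_gt0] := posnP m.
  apply: le_trans (LSplus_reward_le2 _ _ k_gt0 Lx) _.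
  rewrite ler_pM2r//.
  move: k_le; rewrite m0 -(ler_nat R) => k_le.
  have [|s12] := leP 1 (12 * s); first by lra.
  have : 1 <= 2 * s ^+ 3.
    by rewrite -[leLHS]ks ler_wpM2r// exprn_ge0// ltW.
  have : (12 * s) ^+ 3 <= 1 by rewrite exprn_ile1 ?mulr_ge0 ?ltW.
  rewrite exprMn; lra.
apply: le_trans (LSplus_reward_le _ _ opt_gt0 m_gt0 m_small Lx) _.
rewrite ler_pM2r// lerD2l.
have m1 : 1 <= m%:R :> R by rewrite ler1n.
have k16 : k%:R <= 16 * m%:R ^+ 3 :> R.
  rewrite -natrX -natrM ler_nat (leq_trans k_le)//.
  rewrite (_ : 16 = 2 * 2 ^ 3)%N// -mulnA leq_mul2l/= -expnMn leq_exp2r//.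
  by rewrite mul2n -addnn -addn1 leq_add2l.
rewrite ler_pdivrMr ?ltr0n// leNgt; apply/negP => small_ms.
have : (3 * (s * m%:R)) ^+ 3 <= 1.
  rewrite exprn_ile1 ?mulr_ge0 ?ler0n ?(ltW s_gt0)//; lra.
have : 1 <= 16 * (m%:R * s) ^+ 3.
  rewrite exprMn mulrA -[leLHS]ks ler_wpM2r// exprn_ge0// ltW//.
rewrite exprMn (mulrC s); lra.
Qed.
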